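(* Let $\mathbf{Ax}$ be the set of axiom schemas consisting of $\alpha\to\neg\neg\alpha$; $\neg(\alpha\vee\beta)\leftrightarrow(\neg\alpha\wedge\neg\beta)$; $\neg(\alpha\wedge\beta)\leftrightarrow(\neg\alpha\vee\neg\beta)$; $\neg(\alpha\to\beta)\leftrightarrow(\alpha\wedge\neg\beta)$. Then $$\mathbb{K}_{\mathbf{LFI1}_\circ}=\{\mathcal{B}\in\mathbb{K}_{\mathbf{Ci}}:\mathcal{M}(\mathcal{B})\text{ validates all the axioms in }\mathbf{Ax}\}.$$
   Context: Let $\Sigma=\{\wedge,\vee,\to,\neg,\circ\}$ ($\neg,\circ$ unary, the others binary); $For(\Sigma)$ is the set of formulas over $\Sigma$ generated by a denumerable set of propositional variables, and $\alpha\leftrightarrow\beta$ abbreviates $(\alpha\to\beta)\wedge(\beta\to\alpha)$. A multialgebra over $\Sigma$ is a nonempty set with operations whose values are nonempty subsets. Elements of swap structures are here pairs. For a Boolean algebra $\mathcal{A}$ with domain $A$ (the one-element Boolean algebra is allowed), complement $\sim$, a swap structure for $\mathbf{Ci}$ over $\mathcal{A}$ is a multialgebra $\mathcal{B}$ over $\Sigma$ with domain $|\mathcal{B}|=B\subseteq\{(z_1,z_2)\in A^2:z_1\vee z_2=1\}$ such that $0\in\{z_1:z\in B\}$ and for all $z,w\in B$: $\emptyset\ne z\#w\subseteq\{u\in B:u_1=z_1\#w_1\}$ for $\#\in\{\wedge,\vee,\to\}$; $\emptyset\ne\neg z\subseteq\{u\in B:u_1=z_2\text{ and }u_2\le z_1\}$;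 $\circ z=\{({\sim}(z_1\wedge z_2),z_1\wedge z_2)\}$. $\mathbb{K}_{\mathbf{Ci}}$ is the class of all of these over arbitrary Boolean algebras. $\mathbb{K}_{\mathbf{LFI1}_\circ}$ is the class of those $\mathcal{B}\in\mathbb{K}_{\mathbf{Ci}}$ whose multioperations are single-valued and given by $z\wedge w=\{(z_1\wedge w_1,z_2\vee w_2)\}$, $z\vee w=\{(z_1\vee w_1,z_2\wedge w_2)\}$, $z\to w=\{(z_1\to w_1,z_1\wedge w_2)\}$, $\neg z=\{(z_2,z_1)\}$, $\circ z=\{({\sim}(z_1\wedge z_2),z_1\wedge z_2)\}$ for all $z,w\in B$. $\mathcal{M}(\mathcal{B})=(\mathcal{B},D_{\mathcal{B}})$ is the Nmatrix with designated set $D_{\mathcal{B}}=\{z\in B:z_1=1\}$. A valuation over $\mathcal{M}(\mathcal{B})$ is $v:For(\Sigma)\to B$ with $v(\alpha\#\beta)\in v(\alpha)\#v(\beta)$, $v(\neg\alpha)\in\neg v(\alpha)$, $v(\circ\alpha)\in\circ v(\alpha)$. $\mathcal{M}(\mathcal{B})$ validates an axiom schema if $v(\gamma)\in D_{\mathcal{B}}$ for every instance $\gamma$ and every valuation $v$. *)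

(* Defs.v *)
From mathcomp Require Import all_boot all_order.
From mathcomp Require Import boolp classical_sets.

Set Implicit Arguments.
Unset Strict Implicit.
Unset Printing Implicit Defensive.

Local Open Scope classical_set_scope.

Inductive binary_connective := And | Or | Imp.
Inductive unary_connective := Neg | Circ.

Inductive formula :=
| Var of nat
| Bin of binary_connective & formula & formula
| Un of unary_connective & formula.

Declare Scope formula_scope.
Delimit Scope formula_scope with F.
Bind Scope formula_scope with formula.
Notation "a ∧ b" := (Bin And a b)
  (at level 40, left associativity) : formula_scope.
Notation "a ∨ b" := (Bin Or a b)
  (at level 50, left associativity) : formula_scope.
Notation "a → b" := (Bin Imp a b)
  (at level 60, right associativity) : formula_scope.
Notation "¬ a" := (Un Neg a) (at level 35, right associativity) : formula_scope.
Notation "∘ a" := (Un Circ a) (at level 35, right associativity) : formula_scope.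
Notation "a ↔ b" := ((a → b) ∧ (b → a))%F
  (at level 65, no associativity) : formula_scope.

Record multialgebra (T : Type) := Multialgebra {
  binop : binary_connective -> T -> T -> set T;
  unop : unary_connective -> T -> set T;
  carrier_nonempty : [set: T] !=set0;
  binop_nonempty : forall c z w, binop c z w !=set0;
  unop_nonempty : forall c z, unop c z !=set0
}.

Record nmatrix (T : Type) := Nmatrix {
  nmatrix_alg : multialgebra T;
  designated : set T
}.

Definition valuation (T : Type) (M : nmatrix T) (v : formula -> T) : Prop :=
  (forall c a b,
     binop (nmatrix_alg M) c (v a) (v b) (v (Bin c a b))) /\
  (forall c a, unop (nmatrix_alg M) c (v a) (v (Un c a))).

(* An axiom schema is identified with the set of its instances. *)
Definition validates (T : Type) (M : nmatrix T) (schema : set formula) : Prop :=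
  forall g, schema g -> forall v, valuation M v -> designated M (v g).

Definition bool_op (d : Order.disp_t) (A : ctbDistrLatticeType d)
    (c : binary_connective) : A -> A -> A :=
  match c with
  | And => fun x y => Order.meet x y
  | Or => fun x y => Order.join x y
  | Imp => fun x y => Order.join (Order.compl x) y
  end.

(* A multialgebra whose elements are pairs over a Boolean algebra. The display
   [disp] carries no mathematical content, and [ctbDistrLatticeType] does not
   exclude the one-element algebra. *)
Record pair_multialgebra := PairMultialgebra {
  disp : Order.disp_t;
  balg : ctbDistrLatticeType disp;
  domain : set (balg * balg);
  malg : multialgebra domain
}.
Arguments domain : clear implicits.

(* The classes below are plain predicates rather than [set pair_multialgebra],
   because [set] is too small a universe for structures over an arbitrary
   [ctbDistrLatticeType]. *)
Definition K_Ci (B : pair_multialgebra) : Prop :=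
  [/\ (forall z : domain B, Order.join (val z).1 (val z).2 = Order.top),
      (exists z : domain B, (val z).1 = Order.bottom),
      (forall c (z w : domain B),
         binop (malg B) c z w `<=`
           [set u | (val u).1 = bool_op c (val z).1 (val w).1]),
      (forall z : domain B,
         unop (malg B) Neg z `<=`
           [set u | (val u).1 = (val z).2 /\ ((val u).2 <= (val z).1)%O]) &
      (forall z : domain B,
         val @` unop (malg B) Circ z =
           [set (Order.compl (Order.meet (val z).1 (val z).2),
                 Order.meet (val z).1 (val z).2)])].

Definition K_LFI1o (B : pair_multialgebra) : Prop :=
  K_Ci B /\
  [/\ (forall z w : domain B,
         val @` binop (malg B) And z w =
           [set (Order.meet (val z).1 (val w).1,
                 Order.join (val z).2 (val w).2)]),
      (forall z w : domain B,
         val @` binop (malg B) Or z w =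
           [set (Order.join (val z).1 (val w).1,
                 Order.meet (val z).2 (val w).2)]),
      (forall z w : domain B,
         val @` binop (malg B) Imp z w =
           [set (bool_op Imp (val z).1 (val w).1,
                 Order.meet (val z).1 (val w).2)]),
      (forall z : domain B,
         val @` unop (malg B) Neg z = [set ((val z).2, (val z).1)]) &
      (forall z : domain B,
         val @` unop (malg B) Circ z =
           [set (Order.compl (Order.meet (val z).1 (val z).2),
                 Order.meet (val z).1 (val z).2)])].

Definition swap_nmatrix (B : pair_multialgebra) : nmatrix (domain B) :=
  Nmatrix (malg B) [set z | (val z).1 = Order.top].

Definition dneg_schema : set formula :=
  [set g | exists a, g = (a → ¬ ¬ a)%F].
Definition neg_or_schema : set formula :=
  [set g | exists a b, g = (¬ (a ∨ b) ↔ (¬ a ∧ ¬ b))%F].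
Definition neg_and_schema : set formula :=
  [set g | exists a b, g = (¬ (a ∧ b) ↔ (¬ a ∨ ¬ b))%F].
Definition neg_imp_schema : set formula :=
  [set g | exists a b, g = (¬ (a → b) ↔ (a ∧ ¬ b))%F].

Definition Ax : set (set formula) :=
  [set dneg_schema; neg_or_schema; neg_and_schema; neg_imp_schema].

(* Main.v *)
Require Import Defs.
From mathcomp Require Import all_boot all_order.
From mathcomp Require Import boolp classical_sets.

(** In any swap structure for Ci the first coordinate of every connective is
    forced, and the first coordinate of a negation is the second coordinate of
    the negated formula. Hence under a valuation [v] each axiom says exactly
    that the second coordinate of [v (¬ a)], resp. of [v (a # b)], is the one
    prescribed by LFI1. Conversely, every element of a multioperation is the
    value of a formula: a single-valued refinement of the multialgebra can be
    chosen to pass through that element, and any interpretation of the variables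
    extends homomorphically along the refinement to a valuation. *)

Set Implicit Arguments.
Unset Strict Implicit.
Unset Printing Implicit Defensive.

Import Order.Theory.
Local Open Scope classical_set_scope.
Local Open Scope order_scope.

Lemma bool_imp_top (d : Order.disp_t) (A : ctbDistrLatticeType d) (x y : A) :
  bool_op Imp x y = \top <-> x <= y.
Proof.
rewrite /=; split=> [cover|le_xy].
  (* As the complement of [x] and [y] join to top, [x <= y] can be tested after meeting [x] with its
     complement, which gives bottom. *)
  by rewrite -(cover_leIxl _ cover) meetxC le0x.
by apply/eqP; rewrite -le1x -(joinCx x) leU2.
Qed.

Lemma bool_iff_top (d : Order.disp_t) (A : ctbDistrLatticeType d) (x y : A) :
  bool_op And (bool_op Imp x y) (bool_op Imp y x) = \top <-> x = y.
Proof.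
split=> [/eqP|->]; last by rewrite (bool_imp_top y y).2 //= meetxx.
by rewrite meet_eq1 => /andP[/eqP/bool_imp_top xy /eqP/bool_imp_top yx];
  apply/le_anti/andP.
Qed.

Section Valuations.
Variables (T : Type) (M : nmatrix T).
Local Notation bin := (binop (nmatrix_alg M)).
Local Notation un := (unop (nmatrix_alg M)).

(** The homomorphism from the free formula algebra extending [e]; it is a valuation as soon as [f]
    and [g] select from the multioperations. *)
Fixpoint hom_extension (e : nat -> T) (f : binary_connective -> T -> T -> T)
    (g : unary_connective -> T -> T) (a : formula) : T :=
  match a with
  | Var n => e n
  | Bin c a b => f c (hom_extension e f g a) (hom_extension e f g b)
  | Un c a => g c (hom_extension e f g a)
  end.

Lemma refine_binop c0 z0 w0 u0 : bin c0 z0 w0 u0 ->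
  exists f, (forall c z w, bin c z w (f c z w)) /\ f c0 z0 w0 = u0.
Proof.
move=> u0P.
(* Choice over all argument triples at once; the implication pins the selected value at the given
   triple. *)
have /choice[f fP] : forall t : binary_connective * T * T, exists u,
    bin t.1.1 t.1.2 t.2 u /\ (t = (c0, z0, w0) -> u = u0).
  move=> [[c z] w] /=.
  have [[-> -> ->]|neq] := pselect ((c, z, w) = (c0, z0, w0)); first by exists u0.
  by have [u] := binop_nonempty (nmatrix_alg M) c z w; exists u.
exists (fun c z w => f (c, z, w)); split=> [c z w|]; first exact: (fP (c, z, w)).1.
exact: (fP _).2.
Qed.

Lemma refine_unop c0 z0 u0 : un c0 z0 u0 ->
  exists g, (forall c z, un c z (g c z)) /\ g c0 z0 = u0.
Proof.
move=> u0P.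
have /choice[g gP] : forall t : unary_connective * T, exists u,
    un t.1 t.2 u /\ (t = (c0, z0) -> u = u0).
  move=> [c z] /=.
  have [[-> ->]|neq] := pselect ((c, z) = (c0, z0)); first by exists u0.
  by have [u] := unop_nonempty (nmatrix_alg M) c z; exists u.
exists (fun c z => g (c, z)); split=> [c z|]; first exact: (gP (c, z)).1.
exact: (gP _).2.
Qed.

Lemma valuation_through_binop c z w u : bin c z w u ->
  exists2 v, valuation M v &
    [/\ v (Var 0) = z, v (Var 1) = w & v (Bin c (Var 0) (Var 1)) = u].
Proof.
move=> uP; have [f [fP fu]] := refine_binop uP.
have [g gP] : exists g, forall c z, un c z (g c z).
  (* No unary value is prescribed, so an arbitrary [y] in the negation of [z] is used to obtain a
     selector. *)
  have [y yP] := unop_nonempty (nmatrix_alg M) Neg z.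
  by have [g [gP _]] := refine_unop yP; exists g.
by exists (hom_extension (fun n => if n is 0%N then z else w) f g).
Qed.

Lemma valuation_through_unop c z u : un c z u ->
  exists2 v, valuation M v & v (Var 0) = z /\ v (Un c (Var 0)) = u.
Proof.
move=> uP; have [g [gP gu]] := refine_unop uP.
have [f fP] : exists f, forall c z w, bin c z w (f c z w).
  have [y yP] := binop_nonempty (nmatrix_alg M) And z z.
  by have [f [fP _]] := refine_binop yP; exists f.
by exists (hom_extension (fun=> z) f g).
Qed.

End Valuations.

(** The second coordinate prescribed by LFI1, which is also the first coordinate that Ci forces on
    [neg_bin]. *)
Definition snd_op (d : Order.disp_t) (A : ctbDistrLatticeType d)
    (c : binary_connective) (x y : A * A) : A :=
  match c with
  | And => x.2 `|` y.2
  | Or => x.2 `&` y.2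
  | Imp => x.1 `&` y.2
  end.

Definition neg_bin (c : binary_connective) (a b : formula) : formula :=
  match c with
  | And => ¬ a ∨ ¬ b
  | Or => ¬ a ∧ ¬ b
  | Imp => a ∧ ¬ b
  end%F.

Definition neg_bin_schema (c : binary_connective) : set formula :=
  [set g | exists a b, g = (¬ (Bin c a b) ↔ neg_bin c a b)%F].

(** Makes the three negation axioms one family indexed by the connective, so that a single argument
    treats them. *)
Lemma AxE : Ax = dneg_schema |` range neg_bin_schema.
Proof.
apply/seteqP; split=> s.
  by case=> [[[]|]|] ->;
    [left | right; exists Or | right; exists And | right; exists Imp].
case=> [->|[[] _ <-]]; first by left; left; left.
- by left; right.
- by left; left; right.
- by right.
Qed.

Section SwapStructures.
Variable B : pair_multialgebra.
Hypothesis BCi : K_Ci B.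
Local Notation M := (swap_nmatrix B).

Section FirstCoordinates.
Variable v : formula -> domain B.
Hypothesis vM : valuation M v.

Lemma val_bin1 c a b :
  (val (v (Bin c a b))).1 = bool_op c (val (v a)).1 (val (v b)).1.
Proof. by case: BCi => _ _ Bbin _ _; apply/Bbin/vM.1. Qed.

Lemma val_neg1 a : (val (v (¬ a)%F)).1 = (val (v a)).2.
Proof. by case: BCi => _ _ _ Bneg _; apply: (Bneg _ _ (vM.2 Neg a)).1. Qed.

Lemma val_neg2_le a : (val (v (¬ a)%F)).2 <= (val (v a)).1.
Proof. by case: BCi => _ _ _ Bneg _; apply: (Bneg _ _ (vM.2 Neg a)).2. Qed.

(** The axiom yields only the inequality from right to left; the opposite one is the bound that Ci
    puts on negations. *)
Lemma designated_dneg a :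
  designated M (v (a → ¬ ¬ a)%F) <-> (val (v (¬ a)%F)).2 = (val (v a)).1.
Proof.
rewrite /= val_bin1 !val_neg1 bool_imp_top; split=> [le|->//].
by apply/le_anti; rewrite val_neg2_le.
Qed.

(** A designated biconditional equates first coordinates, and that of the negated formula is the
    second coordinate of [Bin c a b]. *)
Lemma designated_neg_bin c a b :
  designated M (v (¬ (Bin c a b) ↔ neg_bin c a b)%F) <->
  (val (v (Bin c a b))).2 = snd_op c (val (v a)) (val (v b)).
Proof.
rewrite /= !val_bin1 bool_iff_top val_neg1.
by case: c; rewrite /= val_bin1 ?val_neg1.
Qed.

End FirstCoordinates.

(** For [u] in the negation of [z], a valuation through [u] is tested on the instance at [Var 0]: Ci
    gives the first coordinate of [u], the axiom the second. *)
Lemma validates_dneg :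
  validates M dneg_schema <->
  forall z, unop (malg B) Neg z `<=` [set u | val u = ((val z).2, (val z).1)].
Proof.
split=> [valid z u | neg_eq _ [a ->] v vM].
  case/(@valuation_through_unop _ M) => v vM [<- <-] /=.
  by rewrite [LHS]surjective_pairing val_neg1// (designated_dneg vM _).1//;
    apply: valid; first by exists (Var 0).
by apply/designated_dneg => //; rewrite (neg_eq _ _ (vM.2 Neg a)).
Qed.

Lemma validates_neg_bin c :
  validates M (neg_bin_schema c) <->
  forall z w, binop (malg B) c z w `<=`
    [set u | val u = (bool_op c (val z).1 (val w).1, snd_op c (val z) (val w))].
Proof.
split=> [valid z w u | bin_eq _ [a [b ->]] v vM].
  case/(@valuation_through_binop _ M) => v vM [<- <- <-] /=.
  by rewrite [LHS]surjective_pairing val_bin1// (designated_neg_bin vM _ _ _).1//;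
    apply: valid; first by exists (Var 0), (Var 1).
by apply/designated_neg_bin => //; rewrite (bin_eq _ _ _ (vM.1 c a b)).
Qed.

End SwapStructures.

(** Since multioperations have nonempty values, this trades the singleton equations of [K_LFI1o] for
    the inclusions that validity provides. *)
Lemma image_set1P (S T : Type) (f : S -> T) (X : set S) (y : T) : X !=set0 ->
  f @` X = [set y] <-> X `<=` [set x | f x = y].
Proof.
move=> [x0 Xx0]; split=> [fX x Xx|fX].
  by have : (f @` X) (f x) by [exists x]; rewrite fX.
apply/seteqP; split=> [_ [x /fX <-]|_ ->] //.
by exists x0 => //; apply: fX.
Qed.

Lemma K_LFI1oE (B : pair_multialgebra) : K_Ci B ->
  K_LFI1o B <->
  (forall z, unop (malg B) Neg z `<=` [set u | val u = ((val z).2, (val z).1)]) /\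
  (forall c z w, binop (malg B) c z w `<=`
     [set u | val u = (bool_op c (val z).1 (val w).1, snd_op c (val z) (val w))]).
Proof.
move=> BCi; split=> [[_ [BAnd BOr BImp BNeg _]]|[BNeg BBin]].
  split=> [z|c z w]; first by apply/image_set1P => //; apply: unop_nonempty.
  by apply/image_set1P; [apply: binop_nonempty | case: c].
have [_ _ _ _ BCirc] := BCi.
by do 2?split=> //; move=> *; apply/image_set1P;
  do ?[exact: binop_nonempty | exact: unop_nonempty | exact: BNeg | exact: BBin].
Qed.

Theorem proposition9p5 :
  K_LFI1o =
  (fun B : pair_multialgebra =>
     K_Ci B /\
     (forall schema, Ax schema -> validates (swap_nmatrix B) schema)).
Proof.
apply/funext => B; apply/propext.
have [BCi|nBCi] := pselect (K_Ci B); last by split=> -[].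
rewrite K_LFI1oE// -validates_dneg//; split=> [[dneg bin]|[_ BAx]].
  split=> // s; rewrite AxE => -[->//|[c _ <-]].
  by apply/validates_neg_bin => //; apply: bin.
split=> [|c]; first by apply: BAx; rewrite AxE; left.
by apply/validates_neg_bin => //; apply: BAx; rewrite AxE; right; exists c.
Qed.
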